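(* The following Cayley indices hold, and in each case the Cayley graph on the group with the listed connection set is an MRR for the group (i.e. its Cayley index equals the Cayley index of the group): \begin{itemize} \item $c(\mathbb{Z}_2^4)=8$, with connection set $\{z_1,z_2,z_3,z_4,z_1z_2,z_1z_3,z_2z_4\}$; \item $c(\mathbb{Z}_4\times\mathbb{Z}_2^2)=8$, with connection set $\{z_1^{\pm1},z_2,z_3,(z_1z_2)^{\pm1},(z_1z_3)^{\pm1}\}$; \item $c(\mathbb{Z}_4^2)=4$, with connection set $\{z_1^{\pm1},z_2^{\pm1},z_1^2,(z_1z_2)^{\pm1}\}$; \item $c(\mathbb{Z}_3^3)=12$, with connection set $\{z_1^{\pm1},z_2^{\pm1},z_3^{\pm1},(z_1z_2)^{\pm1},(z_1z_3)^{\pm1},(z_2z_3)^{\pm1}\}$. \end{itemize}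
   Context: All groups and graphs are finite; graphs are simple, undirected and without loops. For a group $G$ and a subset $S\subseteq G$ with $S=S^{-1}$ and $1\notin S$, the Cayley graph $\mathrm{Cay}(G,S)$ with connection set $S$ has vertex set $G$ and edges $\{g,gs\}$ for $g\in G$, $s\in S$. The left-regular representation $L_G$ of $G$ is a subgroup of $\mathrm{Aut}(\mathrm{Cay}(G,S))$. The Cayley index of $\Gamma=\mathrm{Cay}(G,S)$ is $c(\Gamma)=|\mathrm{Aut}(\Gamma):L_G|$, and the Cayley index of the group $G$ is $c(G)=\min_S c(\mathrm{Cay}(G,S))$, the minimum over all subsets $S\subseteq G$ with $S=S^{-1}$ and $1\notin S$. If $c(G)>1$, an MRR (Most Rigid Representation) for $G$ is a Cayley graph $\Gamma$ on $G$ with $c(\Gamma)=c(G)$. For a group presented as $\mathbb{Z}_{i_1}\times\cdots\times\mathbb{Z}_{i_k}$ (written multiplicatively), $\{z_1,\ldots,z_k\}$ denotes the canonical generating set, so $|z_j|=i_j$. *)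

(* Defs.v *)
From HB Require Import structures.
From mathcomp Require Import all_boot all_algebra all_fingroup.

Set Implicit Arguments.
Unset Strict Implicit.
Unset Printing Implicit Defensive.

Local Open Scope group_scope.

Section GraphAut.
Variables (T : finType) (e : rel T).

Definition graph_aut : {set {perm T}} :=
  [set s : {perm T} | [forall x, forall y, e (s x) (s y) == e x y]].

Lemma graph_autP (s : {perm T}) :
  reflect (forall x y, e (s x) (s y) = e x y) (s \in graph_aut).
Proof.
rewrite inE; apply: (iffP forallP) => [h x y|h x].
  by have /forallP/(_ y)/eqP := h x.
by apply/forallP=> y; rewrite h.
Qed.

Lemma graph_aut_group_set : group_set graph_aut.
Proof.
apply/group_setP; split; first by apply/graph_autP => x y; rewrite !perm1.
move=> s t /graph_autP hs /graph_autP ht.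
by apply/graph_autP => x y; rewrite !permM ht hs.
Qed.
Canonical graph_aut_group := Group graph_aut_group_set.

End GraphAut.

Section Cayley.
Variable gT : finGroupType.
Implicit Types S : {set gT}.

(* [S^-1] is the pointwise inverse of the set [S]. *)
Definition connection_set S : bool := (S^-1 == S) && (1 \notin S).

(* [g *: S] is the set of all [g * s] with [s \in S]; the resulting relation is
   symmetric and irreflexive as soon as [S] is a connection set. *)
Definition Cay S : rel gT := fun g h => h \in g *: S.

Lemma Cay_sym S : connection_set S -> symmetric (Cay S).
Proof.
case/andP=> /eqP SV _ g h.
by rewrite /Cay !mem_lcoset -[in RHS]SV inE invMg invgK.
Qed.

Lemma Cay_irr S : connection_set S -> irreflexive (Cay S).
Proof. by case/andP=> _ /negbTE S1 g; rewrite /Cay mem_lcoset mulVg. Qed.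

Definition left_regular : {set {perm gT}} :=
  [set perm (@mulgI gT g) | g in [set: gT]].

Lemma left_regular_group_set : group_set left_regular.
Proof.
apply/group_setP; split.
  by apply/imsetP; exists 1; rewrite ?inE //; apply/permP=> x; rewrite perm1 permE mul1g.
move=> _ _ /imsetP[g _ ->] /imsetP[h _ ->].
apply/imsetP; exists (h * g); rewrite ?inE //.
by apply/permP=> x; rewrite permM !permE mulgA.
Qed.
Canonical left_regular_group := Group left_regular_group_set.

Lemma left_regular_sub_aut S : left_regular \subset graph_aut (Cay S).
Proof.
apply/subsetP=> _ /imsetP[g _ ->]; apply/graph_autP=> x y.
by rewrite /Cay !permE !mem_lcoset invMg -mulgA mulKg.
Qed.

Definition cayley_index S : nat := #|graph_aut (Cay S) : left_regular|.

(* The minimum is over all connection sets; [set0] is one of them. *)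
Definition group_cayley_index : nat :=
  cayley_index [arg min_(S < set0 | connection_set S) cayley_index S].

Lemma connection_set0 : connection_set set0.
Proof. by rewrite /connection_set in_set0 andbT; apply/eqP/setP=> x; rewrite !inE. Qed.

Lemma group_cayley_index_le S :
  connection_set S -> group_cayley_index <= cayley_index S.
Proof.
by rewrite /group_cayley_index; case: arg_minnP => [|S0 _]; [exact: connection_set0 | apply].
Qed.

Lemma group_cayley_index_attained :
  exists2 S, connection_set S & group_cayley_index = cayley_index S.
Proof.
rewrite /group_cayley_index; case: arg_minnP => [|S0 S0c _]; first exact: connection_set0.
by exists S0.
Qed.

Definition is_MRR S : Prop :=
  [/\ connection_set S, (1 < group_cayley_index)%N
    & cayley_index S = group_cayley_index].

End Cayley.

(* In ['Z_n] the group law is addition, so the ring unit [1%R] is the canonical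
   generator, while [1] in group scope is the neutral element. *)
Definition Z2xZ2xZ2xZ2 : finGroupType := ('Z_2 * 'Z_2 * 'Z_2 * 'Z_2)%type.
Definition Z4xZ2xZ2 : finGroupType := ('Z_4 * 'Z_2 * 'Z_2)%type.
Definition Z4xZ4 : finGroupType := ('Z_4 * 'Z_4)%type.
Definition Z3xZ3xZ3 : finGroupType := ('Z_3 * 'Z_3 * 'Z_3)%type.

(* Main.v *)
Require Import Defs.
From HB Require Import structures.
From mathcomp Require Import all_boot all_algebra all_fingroup.

Set Implicit Arguments.
Unset Strict Implicit.
Unset Printing Implicit Defensive.

Local Open Scope group_scope.

(** Left translations act regularly on a Cayley graph, so the Cayley index of a
    connection set is the number of graph automorphisms that fix the identity
    ([cayley_index_rooted]). The index of one connection set is thus a finite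
    count; the work is in the lower bound for all of them, of which there are
    2 ^ 15 for Z_2^4 and 2 ^ 13 for Z_3^3. Three observations make it a small
    computation.

    - A lower bound k on an index needs only k automorphisms. The automorphisms
      fixing 1 are the solutions of a backtracking search over the images of the
      vertices ([cayley_index_solutions]), and [missing] runs this search but
      stops at the k-th solution. The first solution met is the identity, and
      graphs with many automorphisms are done after little backtracking.

    - Complementing a connection set, or taking its preimage under a group
      automorphism, does not change the index ([cayley_index_complement],
      [cayley_index_preim]). A connection set is recorded by its profile, the
      bits telling which of the pairs {x, x^-1} it contains. By induction on the
      lexicographic order of profiles, only those connection sets matter whose
      profile is not lowered by complementation or by one of a few elementary
      automorphisms ([bound_checkP]): about sixty for Z_2^4 and for Z_3^3. The
      two groups of exponent 4 have so few connection sets that complementation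
      alone is enough.

    - The same search, run on the listed connection set with target k + 1, is
      exhaustive and finds exactly k automorphisms; so the lower bound k is
      attained ([computed_MRR]). *)

(** * Backtracking search *)

Section Search.
Variable T : Type.
Variable col : T -> T -> nat.

(** The domains in [Ds] list the images still possible for the vertices in
    [us]; sending [u] to [v] keeps an image of [w] only when its colour seen
    from [v] is the colour of [w] seen from [u]. The partial applications are
    bound by [let] to be evaluated once per row. *)
Definition refine (u v : T) (us : seq T) (Ds : seq (seq T)) : seq (seq T) :=
  let cu := col u in let cv := col v in
  [seq (let c := cu p.1 in [seq y <- p.2 | eqn (cv y) c]) | p <- zip us Ds].

(** The image sequences of the maps on [us] that respect the domains [Ds] and
    preserve the colours of all pairs. *)
Fixpoint solutions (us : seq T) (Ds : seq (seq T)) : seq (seq T) :=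
  match us, Ds with
  | u :: us', D :: Ds' =>
      flatten [seq map (cons v) (solutions us' (refine u v us' Ds')) | v <- D]
  | [::], _ => [:: [::]]
  | _ :: _, [::] => [::]
  end.

(** How many of [k] wanted solutions do not exist. The search stops as soon as
    [k] solutions are found, so no list of solutions is ever built. *)
Fixpoint missing (us : seq T) (Ds : seq (seq T)) (k : nat) : nat :=
  match us, Ds with
  | u :: us', D :: Ds' =>
      foldl (fun k v => if k is 0 then 0
                        else missing us' (refine u v us' Ds') k) k D
  | [::], _ => k.-1
  | _ :: _, [::] => k
  end.

Lemma missingE us Ds k : missing us Ds k = (k - size (solutions us Ds))%N.
Proof.
elim: us Ds k => [|u us IH] [|D Ds] k //=; rewrite ?subn1 ?subn0 //.
elim: D k => [|v D IHD] k /=; first by rewrite subn0.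
rewrite IHD size_cat size_map subnDA; congr (_ - _)%N.
by case: k => [|k]; rewrite ?sub0n // IH.
Qed.

End Search.

(** Carries the search from group elements to their positions in an
    enumeration, where colours are read from a table. *)
Lemma missing_map (T U : Type) (c : T -> U) colT colU us Ds k :
  (forall x y, colU (c x) (c y) = colT x y) ->
  missing colU (map c us) (map (map c) Ds) k = missing colT us Ds k.
Proof.
move=> colE; elim: us Ds k => [|u us IH] [|D Ds] k //=.
have refineE v : refine colU (c u) (c v) (map c us) (map (map c) Ds)
                 = map (map c) (refine colT u v us Ds).
  rewrite /refine; elim: us Ds {IH} => [|w us IHr] [|E Ds] //=.
  rewrite IHr; congr (_ :: _); rewrite filter_map; congr map.
  by apply: eq_filter => y /=; rewrite !colE.
elim: D k => [|v D IHD] k //=; rewrite IHD refineE.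
by case: k => [|k] //; rewrite IH.
Qed.

Section SearchSpec.
Variable T : eqType.
Variable col : T -> T -> nat.

Lemma size_refine u v us Ds :
  size us = size Ds -> size (refine col u v us Ds) = size us.
Proof. by move=> eq_sz; rewrite size_map size_zip -eq_sz minnn. Qed.

Lemma solutions_uniq us Ds : all uniq Ds -> uniq (solutions col us Ds).
Proof.
elim: us Ds => [|u us IH] [|D Ds] //= /andP[].
elim: D => //= v D IHD /andP[vD uD] uDs.
rewrite cat_uniq map_inj_uniq ?IHD // => [|s t []//].
rewrite andbT; apply/andP; split.
  apply: IH; rewrite /refine all_map.
  elim: us Ds uDs {IHD} => [|w us IHr] [|E Ds] //= /andP[uE /IHr->].
  by rewrite filter_uniq.
apply/hasPn => s /flatten_mapP[w wD /mapP[t _ ->]].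
by apply/negP => /mapP[t' _ [eq_wv _]]; rewrite -eq_wv wD in vD.
Qed.

Lemma size_solution us Ds s : s \in solutions col us Ds -> size s = size us.
Proof.
elim: us Ds s => [|u us IH] [|D Ds] s //=; try by rewrite inE => /eqP->.
by case/flatten_mapP=> v _ /mapP[t /IH <- ->].
Qed.

Lemma map_in_solutions (f : T -> T) us Ds : size us = size Ds ->
  (map f us \in solutions col us Ds) =
  all2 (fun u D => f u \in D) us Ds
  && pairwise (fun u u' => col (f u) (f u') == col u u') us.
Proof.
elim: us Ds => [|u us IH] [|D Ds] //= [eq_sz].
have -> : (f u :: map f us \in flatten
    [seq map (cons v) (solutions col us (refine col u v us Ds)) | v <- D])
  = (f u \in D) && (map f us \in solutions col us (refine col u (f u) us Ds)).
  apply/flatten_mapP/andP => [[v vD /mapP[t tS [-> eq_t]]]|[fD fS]].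
    by rewrite eq_t.
  by exists (f u) => //; apply/mapP; exists (map f us).
rewrite -andbA IH ?size_refine //; congr (_ && _).
rewrite andbA; congr (_ && _).
rewrite /refine; elim: us Ds eq_sz {IH} => [|w us IHr] [|E Ds] //= [/IHr->].
rewrite mem_filter eqnE [X in X && _]andbC -!andbA.
by congr (_ && _); rewrite andbCA.
Qed.

End SearchSpec.

(** * The Cayley index and its invariance *)

Section Index.
Variable gT : finGroupType.
Implicit Types S : {set gT}.

Definition rooted_aut S : {set {perm gT}} :=
  [set s in graph_aut (Cay S) | s 1 == 1].

Lemma card_left_regular : #|left_regular gT| = #|gT|.
Proof.
rewrite card_in_imset ?cardsT // => g h _ _ /permP/(_ 1).
by rewrite !permE !mulg1.
Qed.

Lemma cayley_indexE S : cayley_index S = #|graph_aut (Cay S)| %/ #|gT|.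
Proof.
by rewrite /cayley_index -card_left_regular divgS ?left_regular_sub_aut.
Qed.

(** Orbit-stabiliser: left translations make the automorphism group transitive
    on vertices, and their number is the number of vertices. *)
Lemma cayley_index_rooted S : cayley_index S = #|rooted_aut S|.
Proof.
rewrite cayley_indexE.
have orbT : orbit 'P (graph_aut (Cay S)) (1 : gT) = setT.
  apply/setP=> x; rewrite inE; apply/orbitP; exists (perm (@mulgI gT x)).
    by apply: (subsetP (left_regular_sub_aut S)); apply: imset_f; rewrite inE.
  by rewrite /= apermE permE mulg1.
rewrite -(card_orbit_stab 'P [group of graph_aut (Cay S)] (1 : gT)) /=.
rewrite orbT cardsT mulKn; last by apply/card_gt0P; exists 1.
apply: eq_card => s; rewrite !inE; congr (_ && _).
by rewrite sub1set inE /= apermE.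
Qed.

(** A permutation preserves adjacency exactly when it preserves non-adjacency of
    distinct vertices. *)
Lemma cayley_index_complement S : connection_set S ->
  cayley_index (~: (1 |: S)) = cayley_index S.
Proof.
case/andP=> _ nS1; rewrite !cayley_indexE; congr (_ %/ _).
suff -> : graph_aut (Cay (~: (1 |: S))) = graph_aut (Cay S) by [].
have CayC x y : Cay (~: (1 |: S)) x y = ~~ ((x == y) || Cay S x y).
  by rewrite /Cay !mem_lcoset !inE -(inj_eq (mulgI x)) mulKVg mulg1 eq_sym.
have Cayn x : Cay S x x = false by apply/negbTE; rewrite /Cay mem_lcoset mulVg.
apply/setP=> s; apply/graph_autP/graph_autP=> sP x y; last first.
  by rewrite !CayC sP (inj_eq perm_inj).
have := sP x y; rewrite !CayC (inj_eq perm_inj).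
by case: eqVneq => [->|_ /negb_inj]; rewrite ?Cayn.
Qed.

Lemma connection_set_complement S :
  connection_set S -> connection_set (~: (1 |: S)).
Proof.
case/andP=> /eqP SV _; rewrite /connection_set !inE eqxx andbT.
by apply/eqP/setP=> x; rewrite !inE invg_eq1 -[in RHS]SV inE.
Qed.

Section Automorphism.
Variable f : gT -> gT.
Hypotheses (fM : {morph f : x y / x * y}) (f_inj : injective f).

Lemma morph_1 : f 1 = 1.
Proof. by apply: (mulgI (f 1)); rewrite -fM !mulg1. Qed.

Lemma morph_V x : f x^-1 = (f x)^-1.
Proof. by apply: (mulgI (f x)); rewrite -fM !mulgV morph_1. Qed.

Lemma connection_set_preim S :
  connection_set S -> connection_set (f @^-1: S).
Proof.
case/andP=> /eqP SV nS1; rewrite /connection_set inE morph_1 nS1 andbT.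
by apply/eqP/setP=> x; rewrite !inE morph_V -[in RHS]SV inE.
Qed.

(** A group automorphism [f] is a graph isomorphism from the Cayley graph of
    [f @^-1: S] to that of [S], so it conjugates the two automorphism groups. *)
Lemma cayley_index_preim S : cayley_index (f @^-1: S) = cayley_index S.
Proof.
rewrite !cayley_indexE; congr (_ %/ _).
have CayE x y : Cay (f @^-1: S) x y = Cay S (f x) (f y).
  by rewrite /Cay !mem_lcoset inE fM morph_V.
rewrite -(cardJg (graph_aut (Cay (f @^-1: S))) (perm f_inj)).
apply: eq_card => s; rewrite mem_conjg.
apply/graph_autP/graph_autP => sP x y.
  rewrite -[x](permKV (perm f_inj)) -[y](permKV (perm f_inj)).
  have := sP ((perm f_inj)^-1 x) ((perm f_inj)^-1 y).
  by rewrite !CayE -!(permE f_inj) !conjgE !permM !invgK !permKV.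
by rewrite !CayE -!(permE f_inj) !conjgE !permM !invgK !permKV sP.
Qed.

End Automorphism.
End Index.

(** * Counting rooted automorphisms *)

Section Enumeration.
Variable gT : finGroupType.
Implicit Types S : {set gT}.

(** The diagonal has a colour of its own, so that preserving colours entails
    injectivity. *)
Definition colour S (x y : gT) : nat := if x == y then 2 else Cay S x y.

Lemma colour_eq S (s : {perm gT}) : connection_set S ->
  (s \in graph_aut (Cay S))
  = [forall x, forall y, colour S (s x) (s y) == colour S x y].
Proof.
case/andP=> _ nS1.
have Cayn x : Cay S x x = false by apply/negbTE; rewrite /Cay mem_lcoset mulVg.
apply/graph_autP/'forall_forallP => sP x y.
  by rewrite /colour (inj_eq perm_inj) sP.
have /eqP := sP x y; rewrite /colour (inj_eq perm_inj).
by case: eqP => [->|_]; [rewrite !Cayn | case: Cay; case: Cay].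
Qed.

Lemma mem_full_seq (s : seq gT) : uniq s -> size s = #|gT| -> s =i gT.
Proof.
move=> s_uniq s_size x; rewrite inE.
have [_ ->] := @uniq_min_size _ s (enum gT) s_uniq
  (fun y _ => mem_enum gT y) ltac:(by rewrite -cardE s_size).
by rewrite mem_enum.
Qed.

(** The first vertex is fixed; the other ones may go anywhere. *)
Definition root_domains (T : Type) (x0 : T) (us : seq T) : seq (seq T) :=
  [:: x0] :: nseq (size us) (x0 :: us).

Variable us : seq gT.
Let els := 1 :: us.
Hypotheses (els_uniq : uniq els) (els_size : size els = #|gT|).

(** A solution lists the values, in the order of [els], of a map that fixes 1
    and preserves colours: an automorphism of the Cayley graph fixing 1. *)
Lemma cayley_index_solutions S : connection_set S ->
  cayley_index S = size (solutions (colour S) els (root_domains 1 us)).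
Proof.
move=> cS; rewrite cayley_index_rooted.
have memE : els =i gT by apply: mem_full_seq.
have col_sym x y : colour S x y = colour S y x.
  by rewrite /colour eq_sym Cay_sym.
have solE f : (map f els \in solutions (colour S) els (root_domains 1 us))
    = (f 1 == 1)
      && all2rel (fun x y => colour S (f x) (f y) == colour S x y) els.
  rewrite map_in_solutions /= ?size_nseq //; congr (_ && _).
    have fE l : all2 (fun u D => f u \in D) l (nseq (size l) els).
      by elim: l => //= u l ->; rewrite memE inE.
    by rewrite fE andbT inE.
  rewrite -(@pairwise_all2rel _
    (fun x y => colour S (f x) (f y) == colour S x y)) //.
    by move=> x; rewrite /colour !eqxx.
  by move=> x y; rewrite (col_sym (f x)) (col_sym x).
pose L := [seq map s els | s : {perm gT} <- enum (rooted_aut S)].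
have -> : #|rooted_aut S| = size L by rewrite size_map -cardE.
apply/perm_size/uniq_perm.
- rewrite map_inj_uniq ?enum_uniq // => s t /eq_in_map st.
  by apply/permP => x; apply: st; rewrite memE.
- apply: solutions_uniq; suff: all uniq (nseq (size us) els) by [].
  by rewrite all_nseq els_uniq orbT.
move=> t; apply/mapP/idP => [[s + ->] | tS].
  rewrite mem_enum inE colour_eq // solE => /andP[/'forall_forallP sP ->].
  by apply/allrelP => x y _ _; apply: sP.
pose f x := nth 1 t (index x els).
have t_size := size_solution tS.
have tE : map f els = t.
  apply: (@eq_from_nth _ 1); rewrite size_map // => i lt_i.
  by rewrite (nth_map 1) // /f index_uniq.
move: tS; rewrite -tE solE => /andP[f1 /allrelP fP].
have f_col x y : colour S (f x) (f y) = colour S x y.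
  by apply/eqP/fP; rewrite memE.
have f_inj : injective f.
  move=> x y eq_f; have := f_col x y; rewrite eq_f /colour eqxx.
  by case: eqP => // _; case: Cay.
exists (perm f_inj); last by apply: eq_map => x; rewrite permE.
rewrite mem_enum inE colour_eq // permE f1 andbT.
by apply/'forall_forallP => x y; rewrite !permE f_col.
Qed.

(** One element of each pair {x, x^-1}: the one enumerated first. *)
Definition reps : seq gT := [seq x <- us | index x us <= index x^-1 us].

(** The position in [reps] of the pair {y, y^-1}. For [y = 1], which is in no
    pair, it is the size of [reps]. *)
Definition rank (y : gT) : nat := minn (index y reps) (index y^-1 reps).

Definition profile S : bitseq := [seq x \in S | x <- reps].

(** Entry (x, y) tells which bit of a profile decides whether x and y are
    adjacent; this table does not depend on the connection set. *)
Definition quotient_table : seq (seq nat) :=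
  [seq [seq rank (x^-1 * y) | y <- els] | x <- els].

Lemma mem_us x : (x \in us) = (x != 1).
Proof.
have := mem_full_seq els_uniq els_size x; rewrite !inE => us1.
have /andP[n1 _] := els_uniq.
by case: eqVneq us1 => [-> _|_ /= ->] //; rewrite (negbTE n1).
Qed.

Lemma mem_reps y : y != 1 -> (y \in reps) || (y^-1 \in reps).
Proof.
move=> y1; rewrite !mem_filter !mem_us invg_eq1 y1 invgK !andbT.
exact: leq_total.
Qed.

Lemma rank_lt y : y != 1 -> rank y < size reps.
Proof. by rewrite gtn_min !index_mem; apply: mem_reps. Qed.

Lemma profile_rank S y : connection_set S -> y != 1 ->
  nth false (profile S) (rank y) = (y \in S).
Proof.
move=> /andP[/eqP SV _] y1; have lt_y := rank_lt y1.
rewrite (nth_map 1) //; move: lt_y; rewrite /rank /minn.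
case: ifP => _; rewrite index_mem => yr; rewrite nth_index //.
by rewrite -[in RHS]SV inE.
Qed.

(** On the diagonal the rank falls beyond the profile, and the default value 2
    is the diagonal colour. *)
Lemma colour_rank S x y : connection_set S ->
  colour S x y = nth 2 (map nat_of_bool (profile S)) (rank (x^-1 * y)).
Proof.
move=> cS; rewrite /colour eq_mulVg1; case: eqVneq => [xy1|xy1].
  rewrite nth_default // !size_map /rank xy1 invg1 minnn leqNgt index_mem.
  by rewrite mem_filter mem_us eqxx andbF.
rewrite (nth_map false) ?size_map ?rank_lt // profile_rank //.
by rewrite /Cay mem_lcoset.
Qed.

End Enumeration.

(** * Descent on profiles *)

(** The truncated search for the graph with profile [b], on vertices numbered
    by their position in the enumeration behind [table]. *)
Definition missing_profile (table : seq (seq nat)) (b : bitseq) (k : nat) :=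
  let values := map nat_of_bool b in
  let colours := map (map (nth 2 values)) table in
  let col i := let row := nth [::] colours i in fun j => nth 0 row j in
  missing col (iota 0 (size table)) (root_domains 0 (iota 1 (size table).-1)) k.

Fixpoint lex_lt (c b : bitseq) : bool :=
  match c, b with
  | x :: c', y :: b' => if x == y then lex_lt c' b' else y
  | _, _ => false
  end.

Fixpoint binary_value (b : bitseq) : nat :=
  if b is x :: b' then x * 2 ^ size b' + binary_value b' else 0.

Lemma binary_value_lt b : binary_value b < 2 ^ size b.
Proof.
elim: b => //= x b IH; rewrite expnS mul2n -addnn -ltn_subRL.
case: x; first by rewrite mul1n addnK.
by rewrite mul0n subn0 (leq_trans IH) ?leq_addr.
Qed.

Lemma lex_lt_value c b :
  size c = size b -> lex_lt c b -> binary_value c < binary_value b.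
Proof.
elim: c b => [|x c IH] [|y b] //= [eq_sz].
case: eqP => [-> /IH|]; first by rewrite eq_sz ltn_add2l; apply.
case: x y => [] [] // _ _; rewrite mul0n mul1n add0n -eq_sz.
by rewrite (leq_trans (binary_value_lt c)) ?leq_addr.
Qed.

Fixpoint all_bits (m : nat) (P : pred bitseq) : bool :=
  if m is m'.+1 then
    all_bits m' (fun b => P (false :: b)) && all_bits m' (fun b => P (true :: b))
  else P [::].

Lemma all_bitsP m (P : pred bitseq) b : all_bits m P -> size b = m -> P b.
Proof.
elim: m P b => [|m IH] P [|x b] //= /andP[Pf Pt] [sz_b].
by case: x; [apply: (IH (fun b => P (true :: b)))
            | apply: (IH (fun b => P (false :: b)))].
Qed.

(** Here [p] lists the positions from which an automorphism draws the bits of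
    the new profile. *)
Definition lowers (b : bitseq) (p : seq nat) : bool :=
  lex_lt [seq nth false b i | i <- p] b.

(** A profile starting with [true] is lowered by complementation. The nested
    [if] keep call-by-value evaluation from searching needlessly. *)
Definition bound_check (table : seq (seq nat)) (m : nat)
    (moves : seq (seq nat)) (k : nat) : bool :=
  all_bits m (fun b => if head false b then true
                       else if has (lowers b) moves then true
                       else missing_profile table b k == 0).

Section Bounds.
Variables (gT : finGroupType) (us : seq gT).
Let els := 1 :: us.
Hypotheses (els_uniq : uniq els) (els_size : size els = #|gT|).
Implicit Types S : {set gT}.

Lemma missing_profileE S k : connection_set S ->
  missing_profile (quotient_table us) (profile us S) k = k - cayley_index S.
Proof.
move=> cS; rewrite (cayley_index_solutions els_uniq els_size cS) -missingE.
have lt_index z : index z els < size els by rewrite index_mem mem_full_seq.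
have codeE : map (index^~ els) els = iota 0 (size els).
  apply: (@eq_from_nth _ 0); rewrite size_map ?size_iota // => i lt_i.
  by rewrite (nth_map 1) // nth_iota // index_uniq.
rewrite /missing_profile; set colours := map (map _) _; set col := (X in missing X).
have colE x y : col (index x els) (index y els) = colour S x y.
  rewrite /col /colours (nth_map [::]) ?size_map //.
  rewrite (nth_map 0) /quotient_table (nth_map 1) // ?size_map // -/els.
  rewrite (nth_map 1) // !nth_index ?mem_full_seq //.
  by rewrite (colour_rank els_uniq els_size).
rewrite -(missing_map _ _ _ colE) codeE size_map.
suff -> : map (map (index^~ els)) (root_domains 1 us)
          = root_domains 0 (iota 1 (size us)) by [].
by rewrite /root_domains /= map_nseq -/els codeE size_iota /= eqxx.
Qed.

Section Descent.
Variables (A : eqType) (act : A -> gT -> gT) (moves : seq A).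
Hypothesis act_morph : {in moves, forall a, {morph act a : x y / x * y}}.
Hypothesis act_inj : {in moves, forall a, injective (act a)}.

Definition move_code (a : A) : seq nat := [seq rank us (act a x) | x <- reps us].

(** By induction on the binary value of the profile: a connection set lowered
    by complementation or by a move inherits the bound from the lower set, which
    has the same index, and every other set passes the search. *)
Lemma bound_checkP k :
  bound_check (quotient_table us) (size (reps us)) (map move_code moves) k ->
  forall S, connection_set S -> k <= cayley_index S.
Proof.
move=> check S; have [n] := ubnP (binary_value (profile us S)).
elim: n S => // n IH S; rewrite ltnS => le_n cS.
have descend S' : connection_set S' -> cayley_index S' = cayley_index S ->
    lex_lt (profile us S') (profile us S) -> k <= cayley_index S.
  move=> cS' <- lt_S; apply: IH => //; apply: leq_trans le_n.
  by apply: lex_lt_value => //; rewrite !size_map.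
have := all_bitsP check (size_map _ _ : size (profile us S) = _).
case: ifP => [top _|_].
  apply: descend (connection_set_complement cS) (cayley_index_complement cS) _.
  have -> : profile us (~: (1 |: S)) = map negb (profile us S).
    rewrite /profile -map_comp; apply/eq_in_map => x /=.
    by rewrite mem_filter mem_us // !inE => /andP[_ /negbTE->].
  by case: (profile us S) top => [|[] b].
case: ifP => [/hasP[_ /mapP[a aM ->]] lower _|_ /eqP].
  have [aD aI] := (act_morph aM, act_inj aM).
  apply: descend (connection_set_preim aD cS) (cayley_index_preim aD aI S) _.
  suff -> : profile us (act a @^-1: S)
            = [seq nth false (profile us S) i | i <- move_code a] by [].
  rewrite /profile /move_code -map_comp; apply/eq_in_map => x.
  rewrite mem_filter mem_us // inE => /andP[_ x1] /=.
  by rewrite profile_rank // -(morph_1 aD) (inj_eq aI).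
by rewrite missing_profileE // => /eqP.
Qed.

End Descent.

(** This shape of [S] is what the notation for an explicit finite set unfolds
    to. *)
Lemma computed_MRR (a : gT) (L' : seq gT) k :
  let S := foldl (fun A b => A :|: [set b]) [set a] L' in
  let L := a :: L' in
  all (fun x => x^-1 \in L) L -> 1 \notin L -> (1 < k)%N ->
  (forall S', connection_set S' -> k <= cayley_index S') ->
  missing_profile (quotient_table us) [seq x \in L | x <- reps us] k.+1 = 1%N ->
  group_cayley_index gT = k /\ is_MRR S.
Proof.
move=> S L /allP LV nL1 k1 lower eq1.
have SL : S =i L.
  rewrite /S /L => x; elim/last_ind: (L') => [|l b IH] /=.
    by rewrite !inE.
  by rewrite foldl_rcons -rcons_cons mem_rcons !inE IH inE orbC.
have cS : connection_set S.
  rewrite /connection_set SL nL1 andbT; apply/eqP/setP=> x.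
  by rewrite inE !SL; apply/idP/idP => /LV; rewrite ?invgK.
have Sk : cayley_index S = k.
  apply/eqP; rewrite eqn_leq lower // andbT -ltnS -subn_gt0.
  rewrite -missing_profileE // /profile.
  by under eq_map do rewrite SL; rewrite eq1.
have gk : group_cayley_index gT = k.
  have [S' cS' eqS'] := group_cayley_index_attained gT.
  by apply/eqP; rewrite eqn_leq -{1}Sk group_cayley_index_le // eqS' lower.
by split=> //; split; rewrite ?gk.
Qed.

End Bounds.

(** * Endomorphisms given by the images of the generators *)

Lemma power_morph (gT : finGroupType) n (a : gT) :
  a ^+ n.+1 = 1 -> {morph (fun i : 'I_n.+1 => a ^+ i) : x y / x * y}.
Proof. by move=> an i j; rewrite -expgD -(expg_mod (i + j) an). Qed.

Lemma pair_morph (gT hT kT : finGroupType) (f : gT -> kT) (g : hT -> kT) :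
  commutative (@mulg kT) ->
  {morph f : x y / x * y} -> {morph g : x y / x * y} ->
  {morph (fun x : gT * hT => f x.1 * g x.2) : x y / x * y}.
Proof.
move=> kC fM gM x y; rewrite /= fM gM -!mulgA; congr (_ * _).
by rewrite !mulgA; congr (_ * _); rewrite kC.
Qed.

Lemma pair_mulgC (gT hT : finGroupType) :
  commutative (@mulg gT) -> commutative (@mulg hT) ->
  commutative (@mulg (gT * hT)%type).
Proof.
move=> gC hC [x x'] [y y'].
transitivity (y * x, y' * x'); last by [].
by rewrite gC hC.
Qed.

Lemma morph_inj_ker (gT : finGroupType) (f : gT -> gT) (us : seq gT) :
  uniq (1 :: us) -> size (1 :: us) = #|gT| -> {morph f : x y / x * y} ->
  all (fun x => f x != 1) us -> injective f.
Proof.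
move=> us_uniq us_size fM /allP ker1 x y eq_f.
apply/eqP; rewrite eq_mulVg1; apply: contraT; rewrite -(mem_us us_uniq us_size).
by move/ker1; rewrite fM (morph_V fM) eq_f mulVg eqxx.
Qed.

(** * The four groups *)

Definition words (gT : finGroupType) (gens : seq gT) (orders : seq nat) : seq gT :=
  foldr (fun zn ws => [seq zn.1 ^+ i * w | i <- iota 0 zn.2, w <- ws])
        [:: 1] (zip gens orders).

(** Placing the generators first makes the search fix a frame early, which
    leaves short domains for the other vertices. *)
Definition nonid_generators_first (gT : finGroupType) (gens : seq gT)
    (orders : seq nat) : seq gT :=
  gens ++ [seq x <- words gens orders | x \notin 1 :: gens].

Definition Z2xZ2xZ2xZ2_nonid : seq Z2xZ2xZ2xZ2 :=
  let z1 : Z2xZ2xZ2xZ2 := (1%R, 1, 1, 1) in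
  let z2 : Z2xZ2xZ2xZ2 := (1, 1%R, 1, 1) in
  let z3 : Z2xZ2xZ2xZ2 := (1, 1, 1%R, 1) in
  let z4 : Z2xZ2xZ2xZ2 := (1, 1, 1, 1%R) in
  nonid_generators_first [:: z1; z2; z3; z4] [:: 2; 2; 2; 2].

Lemma Z2xZ2xZ2xZ2_uniq : uniq (1 :: Z2xZ2xZ2xZ2_nonid).
Proof. by vm_compute. Qed.

Lemma Z2xZ2xZ2xZ2_size : size (1 :: Z2xZ2xZ2xZ2_nonid) = #|Z2xZ2xZ2xZ2|.
Proof. by rewrite !card_prod !card_ord. Qed.

Definition Z2xZ2xZ2xZ2_endo
    (a : Z2xZ2xZ2xZ2 * Z2xZ2xZ2xZ2 * Z2xZ2xZ2xZ2 * Z2xZ2xZ2xZ2)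
    (x : Z2xZ2xZ2xZ2) : Z2xZ2xZ2xZ2 :=
  a.1.1.1 ^+ x.1.1.1 * a.1.1.2 ^+ x.1.1.2 * a.1.2 ^+ x.1.2 * a.2 ^+ x.2.

Lemma Z2xZ2xZ2xZ2_endo_morph a :
  all (fun c => c ^+ 2 == 1) [:: a.1.1.1; a.1.1.2; a.1.2; a.2] ->
  {morph Z2xZ2xZ2xZ2_endo a : x y / x * y}.
Proof.
case/and5P=> /eqP a1 /eqP a2 /eqP a3 /eqP a4 _.
have C2 : commutative (@mulg 'Z_2) by exact: Zp_mulgC.
have C : commutative (@mulg Z2xZ2xZ2xZ2).
  exact: (pair_mulgC (pair_mulgC (pair_mulgC C2 C2) C2) C2).
have m12 := pair_morph C (power_morph a1) (power_morph a2).
exact: (pair_morph C (pair_morph C m12 (power_morph a3)) (power_morph a4)).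
Qed.

(** The images of the canonical basis under its transpositions and
    transvections. *)
Definition Z2xZ2xZ2xZ2_moves :=
  let z1 : Z2xZ2xZ2xZ2 := (1%R, 1, 1, 1) in
  let z2 : Z2xZ2xZ2xZ2 := (1, 1%R, 1, 1) in
  let z3 : Z2xZ2xZ2xZ2 := (1, 1, 1%R, 1) in
  let z4 : Z2xZ2xZ2xZ2 := (1, 1, 1, 1%R) in
  [:: (z2, z1, z3, z4); (z3, z2, z1, z4); (z4, z2, z3, z1);
      (z1, z3, z2, z4); (z1, z4, z3, z2); (z1, z2, z4, z3);
      (z1 * z2, z2, z3, z4); (z1 * z3, z2, z3, z4); (z1 * z4, z2, z3, z4);
      (z1, z2 * z1, z3, z4); (z1, z2 * z3, z3, z4); (z1, z2 * z4, z3, z4);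
      (z1, z2, z3 * z1, z4); (z1, z2, z3 * z2, z4); (z1, z2, z3 * z4, z4);
      (z1, z2, z3, z4 * z1); (z1, z2, z3, z4 * z2); (z1, z2, z3, z4 * z3)].

Lemma Z2xZ2xZ2xZ2_moves_ok :
  all (fun a => all (fun c => c ^+ 2 == 1) [:: a.1.1.1; a.1.1.2; a.1.2; a.2]
                && all (fun x => Z2xZ2xZ2xZ2_endo a x != 1) Z2xZ2xZ2xZ2_nonid)
      Z2xZ2xZ2xZ2_moves.
Proof. by vm_compute. Qed.

Lemma Z2xZ2xZ2xZ2_check :
  bound_check (quotient_table Z2xZ2xZ2xZ2_nonid) (size (reps Z2xZ2xZ2xZ2_nonid))
    (map (move_code Z2xZ2xZ2xZ2_nonid Z2xZ2xZ2xZ2_endo) Z2xZ2xZ2xZ2_moves) 8.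
Proof. by vm_compute. Qed.

Lemma Z2xZ2xZ2xZ2_bound (S : {set Z2xZ2xZ2xZ2}) :
  connection_set S -> 8 <= cayley_index S.
Proof.
have endoM : {in Z2xZ2xZ2xZ2_moves,
    forall a, {morph Z2xZ2xZ2xZ2_endo a : x y / x * y}}.
  move=> a /(allP Z2xZ2xZ2xZ2_moves_ok) /andP[a_ok _].
  exact: Z2xZ2xZ2xZ2_endo_morph a_ok.
apply: (bound_checkP Z2xZ2xZ2xZ2_uniq Z2xZ2xZ2xZ2_size endoM _
                     Z2xZ2xZ2xZ2_check) => a aM.
have /andP[_ ker1] := allP Z2xZ2xZ2xZ2_moves_ok a aM.
exact: morph_inj_ker Z2xZ2xZ2xZ2_uniq Z2xZ2xZ2xZ2_size (endoM a aM) ker1.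
Qed.

Definition Z4xZ2xZ2_nonid : seq Z4xZ2xZ2 :=
  let z1 : Z4xZ2xZ2 := (1%R, 1, 1) in
  let z2 : Z4xZ2xZ2 := (1, 1%R, 1) in
  let z3 : Z4xZ2xZ2 := (1, 1, 1%R) in
  nonid_generators_first [:: z1; z2; z3] [:: 4; 2; 2].

Lemma Z4xZ2xZ2_uniq : uniq (1 :: Z4xZ2xZ2_nonid).
Proof. by vm_compute. Qed.

Lemma Z4xZ2xZ2_size : size (1 :: Z4xZ2xZ2_nonid) = #|Z4xZ2xZ2|.
Proof. by rewrite !card_prod !card_ord. Qed.

Lemma Z4xZ2xZ2_check :
  bound_check (quotient_table Z4xZ2xZ2_nonid) (size (reps Z4xZ2xZ2_nonid)) [::] 8.
Proof. by vm_compute. Qed.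

Lemma Z4xZ2xZ2_bound (S : {set Z4xZ2xZ2}) : connection_set S -> 8 <= cayley_index S.
Proof.
by apply: (@bound_checkP _ _ Z4xZ2xZ2_uniq Z4xZ2xZ2_size unit (fun _ => id) [::])
           Z4xZ2xZ2_check S.
Qed.

Definition Z4xZ4_nonid : seq Z4xZ4 :=
  let z1 : Z4xZ4 := (1%R, 1) in
  let z2 : Z4xZ4 := (1, 1%R) in
  nonid_generators_first [:: z1; z2] [:: 4; 4].

Lemma Z4xZ4_uniq : uniq (1 :: Z4xZ4_nonid).
Proof. by vm_compute. Qed.

Lemma Z4xZ4_size : size (1 :: Z4xZ4_nonid) = #|Z4xZ4|.
Proof. by rewrite !card_prod !card_ord. Qed.

Lemma Z4xZ4_check :
  bound_check (quotient_table Z4xZ4_nonid) (size (reps Z4xZ4_nonid)) [::] 4.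
Proof. by vm_compute. Qed.

Lemma Z4xZ4_bound (S : {set Z4xZ4}) : connection_set S -> 4 <= cayley_index S.
Proof.
by apply: (@bound_checkP _ _ Z4xZ4_uniq Z4xZ4_size unit (fun _ => id) [::])
           Z4xZ4_check S.
Qed.

Definition Z3xZ3xZ3_nonid : seq Z3xZ3xZ3 :=
  let z1 : Z3xZ3xZ3 := (1%R, 1, 1) in
  let z2 : Z3xZ3xZ3 := (1, 1%R, 1) in
  let z3 : Z3xZ3xZ3 := (1, 1, 1%R) in
  nonid_generators_first [:: z1; z2; z3] [:: 3; 3; 3].

Lemma Z3xZ3xZ3_uniq : uniq (1 :: Z3xZ3xZ3_nonid).
Proof. by vm_compute. Qed.

Lemma Z3xZ3xZ3_size : size (1 :: Z3xZ3xZ3_nonid) = #|Z3xZ3xZ3|.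
Proof. by rewrite !card_prod !card_ord. Qed.

Definition Z3xZ3xZ3_endo (a : Z3xZ3xZ3 * Z3xZ3xZ3 * Z3xZ3xZ3)
    (x : Z3xZ3xZ3) : Z3xZ3xZ3 :=
  a.1.1 ^+ x.1.1 * a.1.2 ^+ x.1.2 * a.2 ^+ x.2.

Lemma Z3xZ3xZ3_endo_morph a :
  all (fun c => c ^+ 3 == 1) [:: a.1.1; a.1.2; a.2] ->
  {morph Z3xZ3xZ3_endo a : x y / x * y}.
Proof.
case/and4P=> /eqP a1 /eqP a2 /eqP a3 _.
have C3 : commutative (@mulg 'Z_3) by exact: Zp_mulgC.
have C : commutative (@mulg Z3xZ3xZ3).
  exact: (pair_mulgC (pair_mulgC C3 C3) C3).
have m12 := pair_morph C (power_morph a1) (power_morph a2).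
exact: (pair_morph C m12 (power_morph a3)).
Qed.

(** The images of the canonical basis under its transpositions and
    transvections. *)
Definition Z3xZ3xZ3_moves :=
  let z1 : Z3xZ3xZ3 := (1%R, 1, 1) in
  let z2 : Z3xZ3xZ3 := (1, 1%R, 1) in
  let z3 : Z3xZ3xZ3 := (1, 1, 1%R) in
  [:: (z2, z1, z3); (z3, z2, z1); (z1, z3, z2);
      (z1 * z2, z2, z3); (z1 * z2^-1, z2, z3);
      (z1 * z3, z2, z3); (z1 * z3^-1, z2, z3);
      (z1, z2 * z1, z3); (z1, z2 * z1^-1, z3);
      (z1, z2 * z3, z3); (z1, z2 * z3^-1, z3);
      (z1, z2, z3 * z1); (z1, z2, z3 * z1^-1);
      (z1, z2, z3 * z2); (z1, z2, z3 * z2^-1)].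

Lemma Z3xZ3xZ3_moves_ok :
  all (fun a => all (fun c => c ^+ 3 == 1) [:: a.1.1; a.1.2; a.2]
                && all (fun x => Z3xZ3xZ3_endo a x != 1) Z3xZ3xZ3_nonid)
      Z3xZ3xZ3_moves.
Proof. by vm_compute. Qed.

Lemma Z3xZ3xZ3_check :
  bound_check (quotient_table Z3xZ3xZ3_nonid) (size (reps Z3xZ3xZ3_nonid))
    (map (move_code Z3xZ3xZ3_nonid Z3xZ3xZ3_endo) Z3xZ3xZ3_moves) 12.
Proof. by vm_compute. Qed.

Lemma Z3xZ3xZ3_bound (S : {set Z3xZ3xZ3}) :
  connection_set S -> 12 <= cayley_index S.
Proof.
have endoM : {in Z3xZ3xZ3_moves,
    forall a, {morph Z3xZ3xZ3_endo a : x y / x * y}}.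
  move=> a /(allP Z3xZ3xZ3_moves_ok) /andP[a_ok _].
  exact: Z3xZ3xZ3_endo_morph a_ok.
apply: (bound_checkP Z3xZ3xZ3_uniq Z3xZ3xZ3_size endoM _ Z3xZ3xZ3_check) => a aM.
have /andP[_ ker1] := allP Z3xZ3xZ3_moves_ok a aM.
exact: morph_inj_ker Z3xZ3xZ3_uniq Z3xZ3xZ3_size (endoM a aM) ker1.
Qed.

Theorem mainTheorem3 :
  [/\ (let z1 : Z2xZ2xZ2xZ2 := (1%R, 1, 1, 1) in
       let z2 : Z2xZ2xZ2xZ2 := (1, 1%R, 1, 1) in
       let z3 : Z2xZ2xZ2xZ2 := (1, 1, 1%R, 1) in
       let z4 : Z2xZ2xZ2xZ2 := (1, 1, 1, 1%R) in
       group_cayley_index Z2xZ2xZ2xZ2 = 8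
       /\ is_MRR [set z1; z2; z3; z4; z1 * z2; z1 * z3; z2 * z4]),
      (let z1 : Z4xZ2xZ2 := (1%R, 1, 1) in
       let z2 : Z4xZ2xZ2 := (1, 1%R, 1) in
       let z3 : Z4xZ2xZ2 := (1, 1, 1%R) in
       group_cayley_index Z4xZ2xZ2 = 8
       /\ is_MRR [set z1; z1^-1; z2; z3; z1 * z2; (z1 * z2)^-1;
                      z1 * z3; (z1 * z3)^-1]),
      (let z1 : Z4xZ4 := (1%R, 1) in
       let z2 : Z4xZ4 := (1, 1%R) in
       group_cayley_index Z4xZ4 = 4
       /\ is_MRR [set z1; z1^-1; z2; z2^-1; z1 ^+ 2;
                      z1 * z2; (z1 * z2)^-1])
    & (let z1 : Z3xZ3xZ3 := (1%R, 1, 1) in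
       let z2 : Z3xZ3xZ3 := (1, 1%R, 1) in
       let z3 : Z3xZ3xZ3 := (1, 1, 1%R) in
       group_cayley_index Z3xZ3xZ3 = 12
       /\ is_MRR [set z1; z1^-1; z2; z2^-1; z3; z3^-1;
                      z1 * z2; (z1 * z2)^-1; z1 * z3; (z1 * z3)^-1;
                      z2 * z3; (z2 * z3)^-1])].
Proof.
split.
- move=> z1 z2 z3 z4.
  apply: (computed_MRR Z2xZ2xZ2xZ2_uniq Z2xZ2xZ2xZ2_size (a := z1) (L' :=
    [:: z2; z3; z4; z1 * z2; z1 * z3; z2 * z4])).
  + by vm_compute.
  + by vm_compute.
  + by [].
  + exact: Z2xZ2xZ2xZ2_bound.
  + by vm_compute.
- move=> z1 z2 z3.
  apply: (computed_MRR Z4xZ2xZ2_uniq Z4xZ2xZ2_size (a := z1) (L' :=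
    [:: z1^-1; z2; z3; z1 * z2; (z1 * z2)^-1;
       z1 * z3; (z1 * z3)^-1])).
  + by vm_compute.
  + by vm_compute.
  + by [].
  + exact: Z4xZ2xZ2_bound.
  + by vm_compute.
- move=> z1 z2.
  apply: (computed_MRR Z4xZ4_uniq Z4xZ4_size (a := z1) (L' :=
    [:: z1^-1; z2; z2^-1; z1 ^+ 2; z1 * z2; (z1 * z2)^-1])).
  + by vm_compute.
  + by vm_compute.
  + by [].
  + exact: Z4xZ4_bound.
  + by vm_compute.
- move=> z1 z2 z3.
  apply: (computed_MRR Z3xZ3xZ3_uniq Z3xZ3xZ3_size (a := z1) (L' :=
    [:: z1^-1; z2; z2^-1; z3; z3^-1; z1 * z2; (z1 * z2)^-1;
       z1 * z3; (z1 * z3)^-1; z2 * z3; (z2 * z3)^-1])).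
  + by vm_compute.
  + by vm_compute.
  + by [].
  + exact: Z3xZ3xZ3_bound.
  + by vm_compute.
Qed.
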